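(* Let $J_0\in\mathbb N_0$ and let $J\ge J_0$ be an integer. Let $\Psi=\{\alpha;\beta^1,\ldots,\beta^r\}\subset L_1(\mathbb R)$ ($r\ge1$) be framelet generators satisfying: (a) $\lim_{j\to\infty}|\widehat\alpha(\lambda_\ell/2^j)|=1$ for every $\ell\ge0$; (b) $|\widehat\alpha(\lambda_\ell/2^{j+1})|^2=|\widehat\alpha(\lambda_\ell/2^j)|^2+\sum_{k=1}^r|\widehat{\beta^k}(\lambda_\ell/2^j)|^2$ for every $j\ge J$ and $\ell\ge0$; (c) $(\operatorname{supp}\widehat\alpha\cap[0,\infty))\cup\bigcup_{k=1}^r(\operatorname{supp}\widehat{\beta^k}\cap[0,\infty))\subset[0,1]$. Let $\{\boldsymbol X_j,w_{j,x}\}_{j\ge0}$ be a nested weighted family constructed with a fixed parameter $0<\gamma<R_{\mathcal M}$ (see context). Let $c=c(\mathcal M,1,2)$ be the Filbir--Mhaskar constant (see context) for $p=2$, $\kappa=1$, and set $C_{\mathcal M}:=2\gamma/c$. Let $s\ge0$ be an integer such that $\rho_s:=C_{\mathcal M}2^{-s}<1$. Then the oversampled semi-discrete framelet system $$\mathrm{FS}_J^{(s)}=\{w_{J+s,x}^{1/2}\varphi_{J,x}:x\in\boldsymbol X_{J+s}\}\cup\{w_{j+1+s,x}^{1/2}\psi^k_{j,x}:x\in\boldsymbol X_{j+1+s},\ j\ge J,\ k=1,\ldots,r\}$$ is a $\rho_s$-nearly tight frame for $L^2(\mathcal M,\mu)$: for all $f\in L^2(\mathcal M,\mu)$, $$(1-\rho_s)\|f\|_{L^2(\mu)}^2\le\sum_{g\in\mathrm{FS}_J^{(s)}}|\langle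 f,g\rangle|^2\le(1+\rho_s)\|f\|_{L^2(\mu)}^2,\qquad \rho_s=C_{\mathcal M}2^{-s}$$ (the sum being over the indexed family). In particular, these systems become asymptotically tight as $s\to\infty$ (i.e. both frame bounds tend to $1$).
   Context: $(\mathcal M,g)$ is a compact, connected, $d$-dimensional smooth Riemannian manifold without boundary, $\mu$ is its Riemannian volume measure normalized so that $\mu(\mathcal M)=1$, $\operatorname{dist}$ is the geodesic distance, and $B(x,R)=\{y:\operatorname{dist}(x,y)\le R\}$. Constants $R_{\mathcal M},c_1,c_2>0$ depending only on $\mathcal M$ are fixed such that $c_1R^d\le\mu(B(x,R))\le c_2R^d$ for all $x\in\mathcal M$, $0<R\le R_{\mathcal M}$. $\{u_\ell\}_{\ell\ge0}$ is an orthonormal basis of $L^2(\mu)$ with $-\Delta_{\mathcal M}u_\ell=\lambda_\ell^2u_\ell$ ($\Delta_{\mathcal M}$ the Laplace--Beltrami operator), $0=\lambda_0\le\lambda_1\le\cdots\to\infty$, and $\mathbb P_n=\operatorname{span}\{u_\ell:\lambda_\ell\le n\}$. $\langle f,g\rangle=\int f\overline g\,d\mu$. Fourier convention: $\widehat h(\xi)=\int_{\mathbb R}h(t)e^{-2\pi it\xi}\,dt$. The generators have Fourier transforms compactly supported on the nonnegative frequency axis. Framelet kernels, for $j\ge J$: $$\varphi_{j,y}(x)=\sum_{\ell\ge0}\widehat\alpha(\lambda_\ell/2^j)\overline{u_\ell(y)}u_\ell(x),\qquad \psi^k_{j,y}(x)=\sum_{\ell\ge0}\widehat{\beta^k}(\lambda_\ell/2^j)\overline{u_\ell(y)}u_\ell(x).$$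 For a finite set $\boldsymbol X\subset\mathcal M$: $h_{\boldsymbol X}=\sup_{y\in\mathcal M}\min_{x\in\boldsymbol X}\operatorname{dist}(y,x)$ and $\operatorname{sep}(\boldsymbol X)=\min_{x\ne y\in\boldsymbol X}\operatorname{dist}(x,y)$ (with the convention $+\infty$ for a one-point set). Nested weighted family constructed with parameter $\gamma$: with $R_j:=\gamma2^{-j}$, finite sets $\boldsymbol X_j\subset\mathcal M$ with $\boldsymbol X_j\subset\boldsymbol X_{j+1}$, $h_{\boldsymbol X_j}\le R_j$, $\operatorname{sep}(\boldsymbol X_j)\ge R_j$, $|\boldsymbol X_j|\asymp R_j^{-d}$ for all $j\ge0$, and partition weights $w_{j,x}=\mu(Y_{j,x})$, where $\{Y_{j,x}\}_{x\in\boldsymbol X_j}$ is the Borel partition of $\mathcal M$ assigning each point to a nearest node of $\boldsymbol X_j$ (ties assigned to the first nearest node in a fixed ordering of $\boldsymbol X_j$). Filbir--Mhaskar constant: by a known theorem, for every $\kappa\ge1$ and $1\le p<\infty$ there is a constant $c=c(\mathcal M,\kappa,p)>0$ with the following property (such a constant is fixed). Let $0<\eta<1$, $n\ge1$, let $\boldsymbol X\subset\mathcal M$ be finite with $h_{\boldsymbol X}\le\kappa\operatorname{sep}(\boldsymbol X)$, and let $\{Y_x\}_{x\in\boldsymbol X}$ be a measurable partition of $\mathcal M$ with $x\in Y_x\subset B(x,h_{\boldsymbol X})$. If $n\,h_{\boldsymbol X}\le c\,\eta/p$, then for every $P\in\mathbb P_n$, $\left|\int_{\mathcal M}|P|^p\,d\mu-\sum_{x\in\boldsymbol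 X}\mu(Y_x)|P(x)|^p\right|\le\eta\int_{\mathcal M}|P|^p\,d\mu$. A system is $\varepsilon$-nearly tight ($0\le\varepsilon<1$) if its squared coefficient sum lies between $(1-\varepsilon)\|f\|^2$ and $(1+\varepsilon)\|f\|^2$ for all $f\in L^2(\mathcal M,\mu)$. *)

(* Defs.v *)
From HB Require Import structures.
From mathcomp Require Import all_boot all_order all_algebra.
From mathcomp Require Import all_classical all_reals all_analysis.
From mathcomp Require Import complex.

Set Implicit Arguments.
Unset Strict Implicit.
Unset Printing Implicit Defensive.

Import Order.TTheory GRing.Theory Num.Theory.
Import numFieldNormedType.Exports.

Local Open Scope classical_set_scope.
Local Open Scope ring_scope.

Section complex_integration.
Context {disp : measure_display} {T : measurableType disp} {R : realType}.
Variable mu : {measure set T -> \bar R}.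
Implicit Types f g : T -> R[i].

Definition cabs (z : R[i]) : R := Normc.normc z.

Definition cintegral f : R[i] :=
  Complex (Rintegral mu setT (fun x => complex.Re (f x)))
          (Rintegral mu setT (fun x => complex.Im (f x))).

Definition L1 f : Prop :=
  mu.-integrable setT (fun x => (complex.Re (f x))%:E) /\
  mu.-integrable setT (fun x => (complex.Im (f x))%:E).

Definition L2 f : Prop :=
  [/\ measurable_fun setT (fun x => complex.Re (f x)),
      measurable_fun setT (fun x => complex.Im (f x)) &
      (\int[mu]_x ((cabs (f x)) ^+ 2)%:E < +oo)%E].

Definition inner f g : R[i] := cintegral (fun x => f x * conjc (g x)).

Definition sqnorm f : R := Rintegral mu setT (fun x => (cabs (f x)) ^+ 2).

(* The family is [g i] for [i] in the index set [D]: repeated elements are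
   counted once per index. *)
Section frames.
Context {I : choiceType}.
Variables (D : set I) (g : I -> T -> R[i]).

Definition coef_sum f : \bar R :=
  (\esum_(i in D) ((cabs (inner f (g i))) ^+ 2)%:E)%E.

Definition is_lower_bound (A : R) : Prop :=
  forall f, L2 f -> ((A * sqnorm f)%:E <= coef_sum f)%E.

Definition is_upper_bound (B : R) : Prop :=
  forall f, L2 f -> (coef_sum f <= (B * sqnorm f)%:E)%E.

Definition nearly_tight (eps : R) : Prop :=
  [/\ 0 <= eps < 1, is_lower_bound (1 - eps) & is_upper_bound (1 + eps)].

Definition lower_frame_bound : \bar R :=
  ereal_sup [set A%:E | A in [set A | is_lower_bound A]].

Definition upper_frame_bound : \bar R :=
  ereal_inf [set B%:E | B in [set B | is_upper_bound B]].

End frames.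

End complex_integration.

Definition asymptotically_tight {disp : measure_display}
    {T : measurableType disp} {R : realType} (mu : {measure set T -> \bar R})
    {I : choiceType} (D : nat -> set I) (g : nat -> I -> T -> R[i]) : Prop :=
  (lower_frame_bound mu (D s) (g s) @[s --> \oo] --> 1%:E) /\
  (upper_frame_bound mu (D s) (g s) @[s --> \oo] --> 1%:E).

Definition cseries {R : realType} (a : nat -> R[i]) : R[i] :=
  Complex (limn (series (fun l => complex.Re (a l))))
          (limn (series (fun l => complex.Im (a l)))).

Section fourier.
Context {R : realType}.
Implicit Types h : R -> R[i].

Definition expi (theta : R) : R[i] := Complex (cos theta) (sin theta).

Definition in_L1R h : Prop := L1 (@lebesgue_measure R) h.

Definition fourier h (xi : R) : R[i] :=
  cintegral (@lebesgue_measure R) (fun t => h t * expi (- (2 * pi * t * xi))).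

Definition supp h : set R := closure [set x | h x != 0].

End fourier.

(* Base point only needed for the Borel sigma-algebra of the library. *)
HB.structure Definition PointedMetric (K : numDomainType) :=
  { M of Pointed M & Metric K M }.
Notation pmetricType := PointedMetric.type.

Definition borel {R : realType} (M : pmetricType R) :=
  g_sigma_algebraType (@open M).

Section smoothness.
Context {R : realType} {d : nat} {V : normedModType R}.

Definition basis_vec (a : 'I_d) : 'rV[R]_d := delta_mx 0 a.

Fixpoint Ck_on (k : nat) (U : set 'rV[R]_d) (f : 'rV[R]_d -> V) : Prop :=
  (forall p, U p -> {for p, continuous f}) /\
  match k with
  | 0 => True
  | k'.+1 => forall a,
      (forall p, U p -> derivable f p (basis_vec a)) /\
      Ck_on k' U (fun p => 'D_(basis_vec a) f p)
  end.

Definition smooth_on (U : set 'rV[R]_d) (f : 'rV[R]_d -> V) : Prop :=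
  forall k, Ck_on k U f.

End smoothness.

(* A smooth atlas on [M] with a metric tensor given in each chart.  The
   topology is the one of [M]; the model space has no boundary. *)
Record riemannian (R : realType) (d : nat) (M : pmetricType R) := Riemannian {
  chart : Type;
  chart_at : M -> chart;
  dom : chart -> set M;
  chart_map : chart -> M -> 'rV[R]_d;
  chart_inv : chart -> 'rV[R]_d -> M;
  tensor : chart -> 'rV[R]_d -> 'M[R]_d;
  dom_chart_at : forall x, dom (chart_at x) x;
  dom_open : forall i, open (dom i);
  image_open : forall i, open (chart_map i @` dom i);
  chart_mapK : forall i x, dom i x -> chart_inv i (chart_map i x) = x;
  chart_map_continuous : forall i x, dom i x -> {for x, continuous (chart_map i)};
  chart_inv_continuous : forall i p, (chart_map i @` dom i) p ->
    {for p, continuous (chart_inv i)};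
  transition_smooth : forall i j,
    smooth_on (chart_map i @` (dom i `&` dom j)) (chart_map j \o chart_inv i);
  tensor_smooth : forall i a b,
    smooth_on (chart_map i @` dom i) (fun p => tensor i p a b : R^o);
  tensor_sym : forall i p, (chart_map i @` dom i) p ->
    (tensor i p)^T = tensor i p;
  tensor_pos : forall i p (v : 'rV[R]_d), (chart_map i @` dom i) p -> v != 0 ->
    0 < (v *m tensor i p *m v^T) 0 0;
  (* row-vector convention: the differential of [f] at [p] is
     [v |-> v *m jacobian f p] *)
  tensor_compat : forall i j x, dom i x -> dom j x ->
    let Jij := jacobian (chart_map j \o chart_inv i) (chart_map i x) in
    tensor i (chart_map i x) = Jij *m tensor j (chart_map j x) *m Jij^T
}.

(* Integral against Lebesgue measure on R^n of a nonnegative Borel function,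
   as an iterated integral (Tonelli). *)
Fixpoint iter_integral {R : realType} (n : nat) :
    ('rV[R]_n -> \bar R) -> \bar R :=
  match n with
  | 0 => fun f => f 0%R
  | n'.+1 => fun f => (\int[@lebesgue_measure R]_t
      iter_integral (fun v : 'rV[R]_n' => f (row_mx (const_mx t : 'rV[R]_1) v)))%E
  end.

Section riemannian_geometry.
Context {R : realType} {d : nat} {M : pmetricType R} (G : riemannian d M).

Definition C1_curve (c : R -> M) : Prop :=
  continuous c /\
  forall (i : chart G) (t : R), dom i (c t) ->
    derivable (chart_map i \o c : R^o -> _) t 1 /\
    {for t, continuous (fun t' : R => 'D_1 (chart_map i \o c : R^o -> _) t')}.

Definition speed (c : R -> M) (t : R) : R :=
  let i := chart_at G (c t) in
  let v := 'D_1 (chart_map i \o c : R^o -> _) t in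
  Num.sqrt ((v *m tensor i (chart_map i (c t)) *m v^T) 0 0).

Definition curve_length (c : R -> M) : \bar R :=
  (\int[@lebesgue_measure R]_(t in `[0%R, 1%R]) (speed c t)%:E)%E.

(* C^1 curves (with possibly vanishing speed) give the same infimum as
   piecewise C^1 ones: reparametrize each piece to stop at the corners. *)
Definition geodesic_dist (x y : M) : \bar R :=
  ereal_inf [set curve_length c |
             c in [set c | [/\ C1_curve c, c 0 = x & c 1 = y]]].

(* The metric structure of [M] is the one induced by the tensor. *)
Definition is_geodesic_metric : Prop :=
  forall x y : M, (mdist x y)%:E = geodesic_dist x y.

Definition vol_density (i : chart G) (p : 'rV[R]_d) : R :=
  Num.sqrt (\det (tensor i p)).

(* [mu] is the Riemannian volume divided by the total volume [V]. *)
Definition is_normalized_volume (mu : probability (borel M) R) : Prop :=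
  exists2 V : R, 0 < V &
    forall (i : chart G) (A : set (borel M)), measurable A -> A `<=` dom i ->
      (V%:E * mu A = iter_integral (fun p =>
         (\1_(chart_map i @` A) p * vol_density i p)%:E))%E.

Definition smooth_fun (f : M -> R) : Prop :=
  forall i : chart G, smooth_on (chart_map i @` dom i) (f \o chart_inv i : _ -> R^o).

(* Laplace--Beltrami operator, [div grad], in local coordinates. *)
Definition laplacian (f : M -> R) (x : M) : R :=
  let i := chart_at G x in
  let flux (a : 'I_d) (q : 'rV[R]_d) : R^o :=
    vol_density i q * \sum_b invmx (tensor i q) a b *
      'D_(basis_vec b) (f \o chart_inv i : _ -> R^o) q in
  (vol_density i (chart_map i x))^-1 *
    \sum_a 'D_(basis_vec a) (flux a) (chart_map i x).

Definition eigenfunction (u : M -> R[i]) (nu : R) : Prop :=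
  [/\ smooth_fun (fun x => complex.Re (u x)),
      smooth_fun (fun x => complex.Im (u x)) &
      forall x, - laplacian (fun y => complex.Re (u y)) x
                  = nu * complex.Re (u x) /\
                - laplacian (fun y => complex.Im (u y)) x
                  = nu * complex.Im (u x)].

Record laplace_eigenbasis (mu : probability (borel M) R)
    (u : nat -> M -> R[i]) (lam : nat -> R) : Prop := LaplaceEigenbasis {
  basis_orthonormal : forall l m,
    inner mu (u l : borel M -> R[i]) (u m) = (l == m)%:R;
  basis_complete : forall f : borel M -> R[i], L2 mu f ->
    sqnorm mu (fun x : borel M => f x - \sum_(l < N) inner mu f (u l) * u l x)
      @[N --> \oo] --> (0 : R);
  basis_eigen : forall l, eigenfunction (u l) (lam l ^+ 2);
  lam0 : lam 0%N = 0;
  lam_nondecreasing : forall l, lam l <= lam l.+1;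
  lam_unbounded : lam l @[l --> \oo] --> +oo
}.

End riemannian_geometry.

Section point_sets.
Context {R : realType} {M : pmetricType R}.
Implicit Types X : seq M.

Definition cball (x : M) (r : \bar R) : set M :=
  [set y | ((mdist x y)%:E <= r)%E].

Definition mesh X : \bar R :=
  ereal_sup [set ereal_inf [set (mdist y x)%:E | x in [set` X]] | y in setT].

Definition sep X : \bar R :=
  ereal_inf [set r | exists x y,
    [/\ x \in X, y \in X, x != y & r = (mdist x y)%:E]].

(* The order of the sequence [X] is the ordering used to break ties. *)
Definition voronoi X (x : M) : set M :=
  [set y | (forall x', x' \in X -> mdist y x <= mdist y x') /\
           (forall x', x' \in X -> mdist y x' = mdist y x ->
              (index x X <= index x' X)%N)].

Definition weight (mu : probability (borel M) R) X (x : M) : R :=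
  fine (mu (voronoi X x)).

Definition node_radius (gamma : R) (j : nat) : R := gamma * 2 ^- j.

Record nested_family (d : nat) (gamma : R) (X : nat -> seq M) : Prop :=
    NestedFamily {
  nodes_uniq : forall j, uniq (X j);
  nodes_nested : forall j, {subset X j <= X j.+1};
  nodes_mesh : forall j, (mesh (X j) <= (node_radius gamma j)%:E)%E;
  nodes_sep : forall j, ((node_radius gamma j)%:E <= sep (X j))%E;
  nodes_card : exists a b : R, [/\ 0 < a, 0 < b & forall j,
    a * node_radius gamma j ^- d <= (size (X j))%:R
      <= b * node_radius gamma j ^- d]
}.

Definition diffusion_poly (u : nat -> M -> R[i]) (lam : nat -> R) (n : nat)
    (P : M -> R[i]) : Prop :=
  exists N (a : nat -> R[i]),
    P = fun x => \sum_(0 <= l < N | lam l <= n%:R) a l * u l x.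

Definition filbir_mhaskar (mu : probability (borel M) R)
    (u : nat -> M -> R[i]) (lam : nat -> R) (kappa p c : R) : Prop :=
  forall (eta : R) (n : nat) (X : seq M) (Y : M -> set (borel M)),
    0 < eta < 1 -> (1 <= n)%N ->
    uniq X -> (mesh X <= kappa%:E * sep X)%E ->
    (forall x, x \in X ->
       [/\ measurable (Y x), Y x x & Y x `<=` cball x (mesh X)]) ->
    trivIset [set` X] Y -> \bigcup_(x in [set` X]) Y x = setT ->
    (n%:R%:E * mesh X <= (c * eta / p)%:E)%E ->
    forall P : M -> R[i], diffusion_poly u lam n P ->
      let I := Rintegral mu setT (fun x : borel M => cabs (P x) `^ p) in
      `| I - \sum_(x <- X) fine (mu (Y x)) * cabs (P x) `^ p | <= eta * I.

(* [framelet u lam h j y] has generator with Fourier transform [h]. *)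
Definition framelet (u : nat -> M -> R[i]) (lam : nat -> R) (h : R -> R[i])
    (j : nat) (y x : M) : R[i] :=
  cseries (fun l => h (lam l / 2 ^+ j) * conjc (u l y) * u l x).

(* [inl x] indexes the low-pass elements, [inr (j, k, x)] the high-pass ones. *)
Definition FS_index (r : nat) : choiceType := (M + nat * 'I_r * M)%type.

Definition FS_dom (r : nat) (X : nat -> seq M) (J s : nat) :
    set (FS_index r) :=
  [set i | match i with
           | inl x => x \in X (J + s)%N
           | inr (j, _, x) => (J <= j)%N && (x \in X (j + 1 + s)%N)
           end].

Definition FS (r : nat) (mu : probability (borel M) R) (u : nat -> M -> R[i])
    (lam : nat -> R) (alpha : R -> R[i]) (beta : 'I_r -> R -> R[i])
    (X : nat -> seq M) (J s : nat) (i : FS_index r) : borel M -> R[i] :=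
  match i with
  | inl y => fun x =>
      Complex (Num.sqrt (weight mu (X (J + s)%N) y)) 0 *
      framelet u lam (fourier alpha) J y x
  | inr (j, k, y) => fun x =>
      Complex (Num.sqrt (weight mu (X (j + 1 + s)%N) y)) 0 *
      framelet u lam (fourier (beta k)) j y x
  end.

End point_sets.

(* Main.v *)
(* For a band-limited generator h, the coefficients of f against the framelets
   of level j are the values at the nodes of the diffusion polynomial
   P = sum_l conj(h(lam_l / 2^j)) <f, u_l> u_l, whose degree is at most 2^j.
   The oversampled nodes are fine enough for the Filbir-Mhaskar inequality to
   hold with eta = rho_s, so each level contributes
   ||P||^2 = sum_l |h(lam_l / 2^j)|^2 |<f, u_l>|^2 up to a relative error rho_s.
   By condition (b) the energies of the levels below J + n telescope to
   sum_l |alpha^(lam_l / 2^(J+n))|^2 |<f, u_l>|^2, and by condition (a) and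
   Parseval this increases to ||f||^2 as n grows. *)
Require Import Defs.
From mathcomp Require Import all_boot all_order all_algebra.
From mathcomp Require Import all_classical all_reals all_analysis.
From mathcomp Require Import measurable_realfun.
From mathcomp Require Import complex ring lra.

Set Implicit Arguments.
Unset Strict Implicit.
Unset Printing Implicit Defensive.

Import Order.TTheory GRing.Theory Num.Theory.
Import numFieldNormedType.Exports.

Local Open Scope classical_set_scope.
Local Open Scope ring_scope.

(** * Modulus, conjugation, real and imaginary parts *)

Section complex_modulus.
Context {R : realType}.
Implicit Types z w : R[i].

Lemma cabs_sqr z : cabs z ^+ 2 = complex.Re z ^+ 2 + complex.Im z ^+ 2.
Proof. by case: z => a b; rewrite /cabs /= sqr_sqrtr// addr_ge0// sqr_ge0. Qed.

Lemma cabs_ge0 z : 0 <= cabs z.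
Proof. by case: z => a b; exact: sqrtr_ge0. Qed.

Lemma cabsM z w : cabs (z * w) = cabs z * cabs w.
Proof. exact: Normc.normcM. Qed.

Lemma cabs_conjc z : cabs (conjc z) = cabs z.
Proof. by case: z => a b; rewrite /cabs /= sqrrN. Qed.

Lemma conjcM z w : conjc (z * w) = conjc z * conjc w.
Proof. exact: rmorphM. Qed.

Lemma mul_conjc z : z * conjc z = (cabs z ^+ 2)%:C%C.
Proof.
rewrite cabs_sqr; case: z => a b.
by apply/eqP; rewrite eq_complex /=; apply/andP; split; apply/eqP; ring.
Qed.

Lemma cabs_real (r : R) : 0 <= r -> cabs r%:C%C = r.
Proof. by move=> r0; rewrite /cabs/= expr0n/= addr0 sqrtr_sqr ger0_norm. Qed.

Lemma Re_mul_conjc z w : complex.Re (z * conjc w) =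
  complex.Re z * complex.Re w + complex.Im z * complex.Im w.
Proof. by case: z w => [a b] [x y] /=; ring. Qed.

Lemma Im_mul_conjc z w : complex.Im (z * conjc w) =
  complex.Im z * complex.Re w - complex.Re z * complex.Im w.
Proof. by case: z w => [a b] [x y] /=; ring. Qed.

Lemma Re_add z w : complex.Re (z + w) = complex.Re z + complex.Re w.
Proof. by case: z w => [a b] [x y]. Qed.

Lemma Im_add z w : complex.Im (z + w) = complex.Im z + complex.Im w.
Proof. by case: z w => [a b] [x y]. Qed.

Lemma Re_mul z w : complex.Re (z * w) =
  complex.Re z * complex.Re w - complex.Im z * complex.Im w.
Proof. by case: z w => [a b] [x y]. Qed.

Lemma Im_mul z w : complex.Im (z * w) =
  complex.Re z * complex.Im w + complex.Im z * complex.Re w.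
Proof. by case: z w => [a b] [x y]. Qed.

Lemma Re_conjc z : complex.Re (conjc z) = complex.Re z.
Proof. by case: z. Qed.

Lemma Im_conjc z : complex.Im (conjc z) = - complex.Im z.
Proof. by case: z. Qed.

End complex_modulus.

(** * Linearity of the complex integral *)

Section L1_theory.
Context {disp : measure_display} {T : measurableType disp} {R : realType}.
Variable mu : {measure set T -> \bar R}.
Implicit Types f g : T -> R[i].

Lemma cintegralD f g : L1 mu f -> L1 mu g ->
  cintegral mu (fun x => f x + g x) = cintegral mu f + cintegral mu g.
Proof.
move=> [f1 f2] [g1 g2]; rewrite /cintegral.
under eq_Rintegral do rewrite Re_add.
under [in X in Complex _ X]eq_Rintegral do rewrite Im_add.
by rewrite !RintegralD.
Qed.

Lemma cintegralZl (a : R[i]) f : L1 mu f ->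
  cintegral mu (fun x => a * f x) = a * cintegral mu f.
Proof.
move=> [f1 f2]; rewrite /cintegral.
under eq_Rintegral do rewrite Re_mul.
under [in X in Complex _ X]eq_Rintegral do rewrite Im_mul.
rewrite RintegralB ?RintegralD ?RintegralZl//.
- by case: a.
all: by rewrite /comp; under eq_fun do rewrite EFinM; exact: integrableZl.
Qed.

Lemma cintegral_conjc f : L1 mu f ->
  cintegral mu (fun x => conjc (f x)) = conjc (cintegral mu f).
Proof.
move=> [f1 f2]; rewrite /cintegral.
under eq_Rintegral do rewrite Re_conjc.
under [in X in Complex _ X]eq_Rintegral do rewrite Im_conjc -mulN1r.
by rewrite RintegralZl// mulN1r.
Qed.

End L1_theory.

(** * Square-integrable functions and the sesquilinear inner product *)

Section L2_theory.
Context {disp : measure_display} {T : measurableType disp} {R : realType}.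
Variable mu : {measure set T -> \bar R}.
Implicit Types f g h : T -> R[i].

Lemma measurable_cabs_sqr f :
  measurable_fun setT (fun x => complex.Re (f x)) ->
  measurable_fun setT (fun x => complex.Im (f x)) ->
  measurable_fun setT (fun x => cabs (f x) ^+ 2).
Proof.
move=> mr mi.
rewrite (_ : (fun x => _) =
  (fun x => complex.Re (f x) ^+ 2) \+ (fun x => complex.Im (f x) ^+ 2)).
  by apply: measurable_funD; apply: measurable_funX.
by apply/funext => x; exact: cabs_sqr.
Qed.

Lemma L2_integrable f : L2 mu f ->
  mu.-integrable setT (EFin \o (fun x => cabs (f x) ^+ 2)).
Proof.
move=> [mr mi fin]; apply/integrableP; split.
  exact/measurable_EFinP/measurable_cabs_sqr.
by under eq_integral do rewrite /= ger0_norm ?sqr_ge0//.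
Qed.

Lemma integrable_L2 f :
  measurable_fun setT (fun x => complex.Re (f x)) ->
  measurable_fun setT (fun x => complex.Im (f x)) ->
  mu.-integrable setT (EFin \o (fun x => cabs (f x) ^+ 2)) -> L2 mu f.
Proof.
move=> mr mi /integrableP[_].
by under eq_integral do rewrite /= ger0_norm ?sqr_ge0//.
Qed.

(** Domination by the pointwise bound |f + g|^2 <= 2 (|f|^2 + |g|^2), which follows from |f - g|^2
    >= 0 taken on real and imaginary parts. *)
Lemma L2D f g : L2 mu f -> L2 mu g -> L2 mu (fun x => f x + g x).
Proof.
move=> Lf Lg; have := L2_integrable Lf; have := L2_integrable Lg.
case: Lf Lg => mf1 mf2 _ [mg1 mg2 _] ig jf.
have m1 : measurable_fun setT (fun x => complex.Re (f x + g x)).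
  by under eq_fun do rewrite Re_add; exact: measurable_funD.
have m2 : measurable_fun setT (fun x => complex.Im (f x + g x)).
  by under eq_fun do rewrite Im_add; exact: measurable_funD.
apply: integrable_L2 => //.
apply: (le_integrable _ _ _
  (integrableZl measurableT 2 (integrableD measurableT jf ig))) => //.
  exact/measurable_EFinP/measurable_cabs_sqr.
move=> x _ /=; rewrite !ger0_norm ?sqr_ge0//; last first.
  by rewrite mulr_ge0// addr_ge0// sqr_ge0.
rewrite lee_fin !cabs_sqr Re_add Im_add.
have := sqr_ge0 (complex.Re (f x) - complex.Re (g x)).
have := sqr_ge0 (complex.Im (f x) - complex.Im (g x)); nra.
Qed.

Lemma L2Zl (a : R[i]) f : L2 mu f -> L2 mu (fun x => a * f x).
Proof.
move=> Lf; have jf := L2_integrable Lf; case: Lf => m1 m2 _.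
apply: integrable_L2.
- under eq_fun do rewrite Re_mul.
  by apply: measurable_funB; apply: measurable_funM => //; exact: measurable_cst.
- under eq_fun do rewrite Im_mul.
  by apply: measurable_funD; apply: measurable_funM => //; exact: measurable_cst.
- rewrite /comp; under eq_fun do rewrite cabsM exprMn EFinM.
  exact: integrableZl.
Qed.

Lemma L2_0 : L2 mu (fun=> 0).
Proof.
split; [exact: measurable_cst..|].
by under eq_integral do rewrite /cabs/= !expr0n/= addr0 sqrtr0 expr0n/=;
  rewrite integral0.
Qed.

(** An equation between functions, with the test on [P i] outside the binder, so that inductions on
    [s] can split on it under [L2] and [inner]. *)
Let sum_cons (I : Type) (i : I) (s : seq I) (P : pred I) (F : I -> T -> R[i]) :
  (fun x => \sum_(j <- i :: s | P j) F j x) =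
  if P i then fun x => F i x + \sum_(j <- s | P j) F j x
  else fun x => \sum_(j <- s | P j) F j x.
Proof. by case: ifPn => Pi; apply/funext => x; rewrite big_cons ?Pi ?(negbTE Pi). Qed.

Lemma L2_sum (I : Type) (s : seq I) (P : pred I) (a : I -> R[i])
    (g : I -> T -> R[i]) : (forall i, P i -> L2 mu (g i)) ->
  L2 mu (fun x => \sum_(i <- s | P i) a i * g i x).
Proof.
move=> Lg; elim: s => [|i s IH].
  by under eq_fun do rewrite big_nil; exact: L2_0.
rewrite sum_cons; case: ifPn => // Pi.
by apply: L2D => //; apply/L2Zl/Lg.
Qed.

(** Since |p q| <= p^2 + q^2 <= |f|^2 + |g|^2, the product has an integrable majorant. It is applied
    with [p] and [q] the real or imaginary parts of [f] and [g]. *)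
Let L2_real_mul (p q : T -> R) f g : L2 mu f -> L2 mu g ->
  measurable_fun setT p -> measurable_fun setT q ->
  (forall x, p x ^+ 2 <= cabs (f x) ^+ 2) ->
  (forall x, q x ^+ 2 <= cabs (g x) ^+ 2) ->
  mu.-integrable setT (EFin \o (fun x => p x * q x)).
Proof.
move=> /L2_integrable jf /L2_integrable jg mp mq pf qg.
apply: (le_integrable _ _ _ (integrableD measurableT jf jg)) => //.
  by apply/measurable_EFinP; exact: measurable_funM.
move=> x _ /=; rewrite (ger0_norm (addr_ge0 _ _)) ?sqr_ge0// lee_fin normrM.
have := pf x; have := qg x.
rewrite -(real_normK (num_real (p x))) -(real_normK (num_real (q x))).
have := sqr_ge0 (`|p x| - `|q x|); nra.
Qed.

Let Re_sqr_le (z : R[i]) : complex.Re z ^+ 2 <= cabs z ^+ 2.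
Proof. by rewrite cabs_sqr lerDl sqr_ge0. Qed.

Let Im_sqr_le (z : R[i]) : complex.Im z ^+ 2 <= cabs z ^+ 2.
Proof. by rewrite cabs_sqr lerDr sqr_ge0. Qed.

Lemma L2_mul_conjc f g : L2 mu f -> L2 mu g -> L1 mu (fun x => f x * conjc (g x)).
Proof.
move=> Lf Lg; have [f1 f2 _] := Lf; have [g1 g2 _] := Lg.
split.
- under eq_fun do rewrite Re_mul_conjc EFinD.
  by apply: integrableD => //; apply: (L2_real_mul Lf Lg).
- under eq_fun do rewrite Im_mul_conjc EFinB.
  by apply: integrableB => //; apply: (L2_real_mul Lf Lg).
Qed.

Lemma inner_conj f g : L2 mu f -> L2 mu g -> inner mu g f = conjc (inner mu f g).
Proof.
move=> Lf Lg; rewrite /inner -cintegral_conjc; last exact: L2_mul_conjc.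
by congr cintegral; apply/funext => x; rewrite rmorphM/= conjcK mulrC.
Qed.

Lemma innerDl f g h : L2 mu f -> L2 mu g -> L2 mu h ->
  inner mu (fun x => f x + g x) h = inner mu f h + inner mu g h.
Proof.
move=> Lf Lg Lh; rewrite /inner -cintegralD; [|exact: L2_mul_conjc..].
by congr cintegral; apply/funext => x; rewrite mulrDl.
Qed.

Lemma innerZl a f h : L2 mu f -> L2 mu h ->
  inner mu (fun x => a * f x) h = a * inner mu f h.
Proof.
move=> Lf Lh; rewrite /inner -cintegralZl; last exact: L2_mul_conjc.
by congr cintegral; apply/funext => x; rewrite mulrA.
Qed.

Lemma innerZr a f h : L2 mu f -> L2 mu h ->
  inner mu h (fun x => a * f x) = conjc a * inner mu h f.
Proof.
move=> Lf Lh.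
by rewrite (inner_conj (L2Zl a Lf) Lh) innerZl// conjcM -(inner_conj Lf Lh).
Qed.

Lemma inner0l h : inner mu (fun=> 0) h = 0.
Proof.
rewrite /inner (_ : (fun x => _) = fun=> 0); last first.
  by apply/funext => x; rewrite mul0r.
by rewrite /cintegral /= Rintegral_cst// mul0r.
Qed.

Lemma inner_suml (I : Type) (s : seq I) (P : pred I) (a : I -> R[i])
    (g : I -> T -> R[i]) h : (forall i, P i -> L2 mu (g i)) -> L2 mu h ->
  inner mu (fun x => \sum_(i <- s | P i) a i * g i x) h =
  \sum_(i <- s | P i) a i * inner mu (g i) h.
Proof.
move=> Lg Lh; elim: s => [|i s IH].
  by rewrite big_nil; under eq_fun do rewrite big_nil; exact: inner0l.
rewrite big_cons sum_cons; case: ifPn => // Pi.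
rewrite innerDl ?IH ?innerZl//; first exact: Lg.
- exact/L2Zl/Lg.
- exact: L2_sum.
Qed.

Lemma inner_sumr (I : Type) (s : seq I) (P : pred I) (a : I -> R[i])
    (g : I -> T -> R[i]) h : (forall i, P i -> L2 mu (g i)) -> L2 mu h ->
  inner mu h (fun x => \sum_(i <- s | P i) a i * g i x) =
  \sum_(i <- s | P i) conjc (a i) * inner mu h (g i).
Proof.
move=> Lg Lh; rewrite (inner_conj (L2_sum _ _ Lg) Lh) inner_suml//.
rewrite rmorph_sum/=; apply: eq_bigr => i Pi.
by rewrite (inner_conj (Lg i Pi) Lh) conjcM.
Qed.

Lemma inner_self f : inner mu f f = (sqnorm mu f)%:C%C.
Proof.
rewrite /inner /cintegral /sqnorm /real_complex_def; congr Complex.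
  by apply: eq_Rintegral => x _; rewrite mul_conjc.
under eq_Rintegral do rewrite mul_conjc/=.
by rewrite Rintegral_cst// mul0r.
Qed.

End L2_theory.

(** * Orthonormal systems: Bessel's inequality and Parseval's identity *)

Section orthonormal.
Context {disp : measure_display} {T : measurableType disp} {R : realType}.
Variables (mu : {measure set T -> \bar R}) (u : nat -> T -> R[i]).
Hypothesis u_L2 : forall l, L2 mu (u l).
Hypothesis u_on : forall l m, inner mu (u l) (u m) = (l == m)%:R.
Implicit Types (f : T -> R[i]) (P : pred nat).

Lemma inner_span_basis (s : seq nat) P (a : nat -> R[i]) (m : nat) : uniq s ->
  inner mu (fun x => \sum_(l <- s | P l) a l * u l x) (u m) =
  if (m \in s) && P m then a m else 0.
Proof.
move=> us; rewrite inner_suml//; case: ifPn => [/andP[ms Pm]|mP].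
  rewrite big_mkcond (bigD1_seq m)//= Pm u_on eqxx mulr1 big1 ?addr0// => l lm.
  by case: ifP => // _; rewrite u_on (negbTE lm) mulr0.
rewrite big_seq_cond big1// => l /andP[ls Pl].
by rewrite u_on; case: eqP => [lm|_]; rewrite ?mulr0//; rewrite -lm ls Pl in mP.
Qed.

Lemma sqnorm_span (s : seq nat) P (a : nat -> R[i]) : uniq s ->
  sqnorm mu (fun x => \sum_(l <- s | P l) a l * u l x) =
  \sum_(l <- s | P l) cabs (a l) ^+ 2.
Proof.
move=> us; apply: complexI; rewrite -inner_self inner_suml//; last exact: L2_sum.
rewrite raddf_sum/= big_seq_cond [RHS]big_seq_cond.
apply: eq_bigr => l /andP[ls Pl]; rewrite -mul_conjc; congr (_ * _).
rewrite (inner_conj (L2_sum _ _ (fun i _ => u_L2 i)) (u_L2 l)).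
by rewrite inner_span_basis// ls Pl.
Qed.

(** The remainder [D] = f - S is orthogonal to the partial sum [S], because <f, S> = <S, S> = [e].
    Hence ||D||^2 = <D, f> = ||f||^2 - <S, f>, and <S, f> is again [e]. *)
Lemma sqnorm_sub_partial_sum f N : L2 mu f ->
  sqnorm mu (fun x => f x - \sum_(l < N) inner mu f (u l) * u l x) =
  sqnorm mu f - \sum_(l < N) cabs (inner mu f (u l)) ^+ 2.
Proof.
move=> Lf; set S := fun x => \sum_(0 <= l < N) inner mu f (u l) * u l x.
have LS : L2 mu S by apply: L2_sum.
have LN : L2 mu (fun x => -1 * S x) by exact: L2Zl.
set e := \sum_(l < N) cabs (inner mu f (u l)) ^+ 2.
have Sf : inner mu S f = e%:C%C.
  rewrite inner_suml// big_mkord rmorph_sum/=; apply: eq_bigr => l _.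
  by rewrite (inner_conj Lf (u_L2 l)) mul_conjc.
have fS : inner mu f S = e%:C%C by rewrite (inner_conj LS Lf) Sf conjc_real.
have SS : inner mu S S = e%:C%C.
  by rewrite inner_self sqnorm_span ?iota_uniq// big_mkord.
set D := fun x => f x + -1 * S x.
have LD : L2 mu D by exact: L2D.
rewrite (_ : (fun x => _) = D); last first.
  by apply/funext => x; rewrite /D /S big_mkord mulN1r.
have DS : inner mu D S = 0 by rewrite innerDl// innerZl// fS SS mulN1r subrr.
have Df : inner mu D f = (sqnorm mu f)%:C%C - e%:C%C.
  by rewrite innerDl// innerZl// Sf mulN1r inner_self.
apply: complexI; rewrite rmorphB/= -inner_self {1}/D innerDl// innerZl//.
rewrite (inner_conj LD LS) DS conjc0 mulr0 addr0 (inner_conj LD Lf) Df.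
by rewrite -rmorphB; exact: conjc_real.
Qed.

Lemma bessel f N : L2 mu f ->
  \sum_(l < N) cabs (inner mu f (u l)) ^+ 2 <= sqnorm mu f.
Proof.
move=> Lf; rewrite -subr_ge0 -sqnorm_sub_partial_sum//.
by apply: Rintegral_ge0 => x _; exact: sqr_ge0.
Qed.

Lemma parseval f : L2 mu f ->
  sqnorm mu (fun x => f x - \sum_(l < N) inner mu f (u l) * u l x)
    @[N --> \oo] --> (0 : R) ->
  \sum_(l < N) cabs (inner mu f (u l)) ^+ 2 @[N --> \oo] --> sqnorm mu f.
Proof.
move=> Lf; under eq_fun do rewrite sqnorm_sub_partial_sum//.
move=> /(cvgB (cvg_cst (sqnorm mu f))); rewrite subr0.
apply: cvg_trans; apply: near_eq_cvg; apply: nearW => N /=.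
by rewrite opprB addrC subrK.
Qed.

End orthonormal.

(** * Borel measurability of continuous functions and of the distance *)

Section borel_measurability.
Context {R : realType} {M : pmetricType R}.

Lemma borel_open (A : set M) : open A -> measurable (A : set (borel M)).
Proof. by move=> oA; exact: sub_sigma_algebra. Qed.

Lemma continuous_borel_measurable (f : M -> R) :
  continuous f -> measurable_fun setT (f : borel M -> R).
Proof.
move=> /continuousP cf; apply: (measurability _ (RGenOpens.measurableE R)).
move=> _ [_ [a [b ->] <-]]; rewrite setTI; apply: borel_open.
exact/cf/interval_open.
Qed.

Lemma continuous_mdist (x : M) : continuous (fun y => mdist y x).
Proof.
move=> y; apply/cvgrPdist_lt => e e0.
apply: filterS (nbhsx_ballx y e e0) => z; rewrite ballEmdist/= => zy.
apply: (le_lt_trans _ zy); have := metric_triangle y z x.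
have := metric_triangle z y x; rewrite (metric_sym z y) => h1 h2.
by rewrite ler_norml; apply/andP; split; lra.
Qed.

Lemma measurable_mdist (x : M) :
  measurable_fun setT (fun y : borel M => mdist y x).
Proof. exact: (continuous_borel_measurable (@continuous_mdist x)). Qed.

End borel_measurability.

(** * The nearest-node cells form a measurable partition *)

Section voronoi_partition.
Context {R : realType} {M : pmetricType R}.
Implicit Types (X : seq M) (x y : M).

Lemma voronoi_measurable X x : measurable (voronoi X x : set (borel M)).
Proof.
have -> : voronoi X x = \bigcap_(x' in [set` X])
    ([set y | mdist y x <= mdist y x'] `&`
     [set y | mdist y x' = mdist y x -> (index x X <= index x' X)%N]).
  apply/seteqP; split => [y [h1 h2] x' /= xX|y h]; first by split; auto.
  by split=> x' xX; case: (h x' xX).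
apply: fin_bigcap_measurable; first exact: finite_seq.
move=> x' _; apply: measurableI.
  rewrite -[X in measurable X]setTI.
  exact: (measurable_fun_ler (measurable_mdist x) (measurable_mdist x')).
(* The index comparison does not involve [y]: the tie-breaking set is either everything or the
   complement of the set where the two distances agree. *)
have [xx'|xx'] := boolP (index x X <= index x' X)%N.
  by rewrite (_ : [set _ | _] = setT)//; apply/seteqP; split.
rewrite (_ : [set _ | _] = ~` (setT `&` [set y | mdist y x' == mdist y x])).
  apply: measurableC.
  exact: (measurable_fun_eqr (measurable_mdist x') (measurable_mdist x)).
rewrite setTI; apply/seteqP; split => y /= h.
  by move=> /eqP /h.
by move=> /eqP.
Qed.

Lemma voronoi_self X x : x \in X -> voronoi X x x.
Proof.
move=> xX; split=> x' x'X; first by rewrite mdistxx mdist_ge0.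
by rewrite mdistxx => /mdist_positivity ->.
Qed.

Lemma voronoi_sub_cball X x : voronoi X x `<=` cball x (mesh X).
Proof.
move=> y [h _]; rewrite /cball /= metric_sym.
apply: (@le_trans _ _ (ereal_inf [set (mdist y x')%:E | x' in [set` X]])).
  by apply/ereal_infP => _ [x' x'X <-]; rewrite lee_fin h.
by apply: ereal_sup_ubound; exists y.
Qed.

(** A point in two cells is equidistant from both nodes, so the tie-breaking rule applies in both
    directions and the nodes have the same index. *)
Lemma voronoi_trivIset X : trivIset [set` X] (voronoi X).
Proof.
move=> x1 x2 /= x1X x2X [y [[h1 k1] [h2 k2]]].
have e : mdist y x1 = mdist y x2 by apply/eqP; rewrite eq_le h1// h2.
have := k1 _ x2X (esym e); have := k2 _ x1X e => a b.
have ii : index x1 X = index x2 X by apply/eqP; rewrite eqn_leq a b.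
by rewrite -(nth_index x1 x1X) ii nth_index.
Qed.

Lemma seq_min_exists (I : eqType) (s : seq I) (f : I -> R) : s != [::] ->
  exists2 i, i \in s & forall j, j \in s -> f i <= f j.
Proof.
elim: s => // a s IH _; have [->|/IH[i si h]] := eqVneq s [::].
  by exists a; rewrite ?mem_seq1// => j; rewrite mem_seq1 => /eqP ->.
have [ai|ia] := leP (f a) (f i).
  exists a; first exact: mem_head.
  by move=> j; rewrite inE => /predU1P[->//|/h]; exact: le_trans.
exists i; first by rewrite inE si orbT.
by move=> j; rewrite inE => /predU1P[->|/h//]; exact: ltW.
Qed.

Lemma voronoi_cover X : X != [::] -> \bigcup_(x in [set` X]) voronoi X x = setT.
Proof.
move=> X0; apply/seteqP; split => // y _.
pose nearest x := all (fun x' => mdist y x <= mdist y x') X.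
have hX : has nearest X.
  have [x xX h] := seq_min_exists (fun x => mdist y x) X0.
  by apply/hasP; exists x => //; apply/allP.
pose x := nth point X (find nearest X).
(* The cell that contains [y] is that of the first node in [X] attaining the minimal distance. *)
have xX : x \in X by rewrite mem_nth// -has_find.
have nx : nearest x by exact: nth_find.
exists x => //; split=> [x'|x' x'X xx']; first exact: (allP nx).
(* The node [x] occurs at position [find nearest X], so its index is at most that. A node [x'] at
   the same distance is itself nearest, so it cannot occur earlier. *)
rewrite (@leq_trans (find nearest X))//; first by
  rewrite leqNgt; apply/negP => /(before_find point); rewrite /= eqxx.
rewrite leqNgt; apply/negP => /(before_find point).
by rewrite nth_index// /nearest xx' -/(nearest x) nx.
Qed.

(** With no nodes, the infimum of distances from [point] is taken over the empty set and equals
    +oo. *)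
Lemma mesh_lt_pinfty_nonempty X : (mesh X < +oo)%E -> X != [::].
Proof.
apply: contraPneq => ->; apply/negP; rewrite -leNgt.
apply: ereal_sup_ubound; exists point => //.
rewrite (_ : [set` [::]] = set0) ?image_set0 ?ereal_inf0//.
by apply/seteqP; split.
Qed.

End voronoi_partition.

(** * Eigenfunctions are continuous and square-integrable *)

Section eigenfunctions.
Context {R : realType} {d : nat} {M : pmetricType R} (G : riemannian d M).

(** On the chart domain around [x], [f] coincides with its coordinate expression composed with the
    chart map; the order 0 clause of smoothness gives continuity of that expression. *)
Lemma smooth_fun_continuous (f : M -> R) : smooth_fun G f -> continuous f.
Proof.
move=> sf x; pose i := chart_at G x; have xi := dom_chart_at G x.
have [/(_ (chart_map i x)) h _] := sf i 0%N.
have {}h := h (ex_intro2 _ _ x xi erefl).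
have := continuous_comp (@chart_map_continuous _ _ _ G i x xi) h.
set g := (f \o chart_inv i) \o chart_map i => cg.
have gx : g x = f x by rewrite /g /= chart_mapK.
have {}cg : g y @[y --> x] --> f x by rewrite -gx; exact: cg.
rewrite /continuous_at; apply: cvg_trans cg; apply: near_eq_cvg.
have : nbhs x (dom i) by apply: open_nbhs_nbhs; split => //; exact: dom_open.
by apply: filterS => y yi; rewrite /g /= chart_mapK.
Qed.

Lemma laplace_eigenbasis_L2 (mu : probability (borel M) R)
    (u : nat -> M -> R[i]) (lam : nat -> R) (l : nat) :
  laplace_eigenbasis G mu u lam -> L2 mu (u l : borel M -> R[i]).
Proof.
move=> ub; have [sr si _] := basis_eigen ub l.
have mr := continuous_borel_measurable (smooth_fun_continuous sr).
have mi := continuous_borel_measurable (smooth_fun_continuous si).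
split=> //.
(* [fine] would send a divergent integral to [0], but the norm is [1] *)
rewrite ltNge leye_eq; apply/negP => /eqP h.
have := basis_orthonormal ub l l; rewrite inner_self eqxx /sqnorm /Rintegral h.
by move=> /(congr1 (@complex.Re R))/eqP; rewrite /= eq_sym oner_eq0.
Qed.

End eigenfunctions.

(** * Framelet coefficients as point values of diffusion polynomials *)

Section framelet_coefficients.
Context {R : realType} {d : nat} {M : pmetricType R} (G : riemannian d M).
Variables (mu : probability (borel M) R) (u : nat -> M -> R[i]) (lam : nat -> R).
Hypothesis u_basis : laplace_eigenbasis G mu u lam.
Implicit Types (h : R -> R[i]) (f : borel M -> R[i]) (N j l : nat).

Lemma cseries_finite (a : nat -> R[i]) N :
  (forall l, (N <= l)%N -> a l = 0) -> cseries a = \sum_(0 <= l < N) a l.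
Proof.
move=> a0.
have lim_const (b : nat -> R) : (forall l, (N <= l)%N -> b l = 0) ->
    limn (series b) = \sum_(0 <= l < N) b l.
  move=> b0; apply: (@lim_near_cst _ (@Rhausdorff R)).
  exists N => // n /= Nn; rewrite /series/= (big_cat_nat (leq0n N) Nn)//=.
  by rewrite [X in _ + X]big_nat_cond [X in _ + X]big1 ?addr0// => l
    /andP[/andP[Nl _] _]; rewrite b0.
rewrite /cseries !lim_const; do ?by move=> l /a0 ->.
elim: (index_iota 0 N) => [|l t IH]; first by rewrite !big_nil.
by rewrite !big_cons -IH; case: (a l).
Qed.

(** With a = 2^j this supplies the truncation index that turns the series of a level-j framelet into
    a finite sum. *)
Lemma eigenvalue_cutoff (a : R) : exists N, forall l, (N <= l)%N -> a < lam l.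
Proof.
have /cvgryPgt/(_ a)[N _ NP] := lam_unbounded u_basis.
by exists N => l Nl; exact: NP.
Qed.

(** One-sided, because the generators are only evaluated at the nonnegative frequencies
    [lam l / 2 ^+ j]. *)
Definition band_limited h := forall xi, 1 < xi -> h xi = 0.

Lemma band_limited_eq0 h j l : band_limited h -> 2 ^+ j < lam l ->
  h (lam l / 2 ^+ j) = 0.
Proof. by move=> hb jl; apply: hb; rewrite ltr_pdivlMr ?mul1r ?exprn_gt0. Qed.

Lemma framelet_finite h j N y : band_limited h ->
  (forall l, (N <= l)%N -> 2 ^+ j < lam l) ->
  framelet u lam h j y =
  fun x => \sum_(0 <= l < N) (h (lam l / 2 ^+ j) * conjc (u l y)) * u l x.
Proof.
move=> hb cut; apply/funext => x; rewrite /framelet (@cseries_finite _ N)// => l Nl.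
by rewrite band_limited_eq0 ?mul0r//; exact: cut.
Qed.

Lemma framelet_L2 h j y : band_limited h ->
  L2 mu (framelet u lam h j y : borel M -> R[i]).
Proof.
move=> hb; have [N cut] := eigenvalue_cutoff (2 ^+ j).
rewrite (framelet_finite _ hb cut).
by apply: L2_sum => l _; exact: laplace_eigenbasis_L2 u_basis.
Qed.

(** As a function of [y] the right-hand side is a diffusion polynomial of degree 2^j: conjugating
    the kernel moves the bar from u_l(y) to [h]. The filter on [lam l] only discards terms that
    vanish by band limitation. *)
Lemma inner_framelet h j N f y : band_limited h -> L2 mu f ->
  (forall l, (N <= l)%N -> 2 ^+ j < lam l) ->
  inner mu f (framelet u lam h j y : borel M -> R[i]) =
  \sum_(0 <= l < N | lam l <= (2 ^ j)%:R)
    (conjc (h (lam l / 2 ^+ j)) * inner mu f (u l : borel M -> R[i])) * u l y.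
Proof.
move=> hb Lf cut; rewrite (framelet_finite _ hb cut).
rewrite inner_sumr//; last by move=> l _; exact: laplace_eigenbasis_L2 u_basis.
rewrite [RHS]big_mkcond/=; apply: eq_bigr => l _; case: ifPn => [_|].
  by rewrite conjcM conjcK mulrAC.
rewrite -ltNge natrX => jl.
by rewrite band_limited_eq0// mul0r conjc0 !mul0r.
Qed.

Lemma inner_weighted_framelet (w : R) h j y f : 0 <= w ->
  band_limited h -> L2 mu f ->
  cabs (inner mu f (fun x => Complex (Num.sqrt w) 0 * framelet u lam h j y x)) ^+ 2
  = w * cabs (inner mu f (framelet u lam h j y : borel M -> R[i])) ^+ 2.
Proof.
move=> w0 hb Lf; rewrite innerZr//; last exact: framelet_L2.
by rewrite cabsM cabs_conjc (cabs_real (sqrtr_ge0 w)) exprMn sqr_sqrtr.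
Qed.

(** For band-limited [h] and [N] past the cut-off of level [j], this is the squared norm of the
    diffusion polynomial of [inner_framelet]. The filter on [lam l] is left out so that energies of
    different levels can be added term by term. *)
Definition band_energy h j N f : R := \sum_(0 <= l < N)
  cabs (h (lam l / 2 ^+ j)) ^+ 2 * cabs (inner mu f (u l : borel M -> R[i])) ^+ 2.

(** The Filbir-Mhaskar inequality with n = 2^j and the Voronoi partition. The radius [rad], lying
    between mesh and separation, gives quasi-uniformity with constant 1. *)
Lemma framelet_quadrature (c eta rad : R) h j N (X : seq M) f :
  filbir_mhaskar mu u lam 1 2 c -> 0 < eta < 1 ->
  uniq X -> (mesh X <= rad%:E)%E -> (rad%:E <= sep X)%E ->
  2 ^+ j * rad <= c * eta / 2 ->
  band_limited h -> L2 mu f -> (forall l, (N <= l)%N -> 2 ^+ j < lam l) ->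
  `|band_energy h j N f - \sum_(x <- X) weight mu X x *
      cabs (inner mu f (framelet u lam h j x : borel M -> R[i])) ^+ 2|
    <= eta * band_energy h j N f.
Proof.
move=> FM eta01 uX meshX sepX jr hb Lf cut.
pose b l := conjc (h (lam l / 2 ^+ j)) * inner mu f (u l : borel M -> R[i]).
pose P := fun y : M => \sum_(0 <= l < N | lam l <= (2 ^ j)%:R) b l * u l y.
(* By orthonormality the integral is the sum of squared coefficients of [P]; frequencies above 2^j
   add nothing to [band_energy]. *)
have PE : Rintegral mu setT (fun x : borel M => cabs (P x) `^ 2) =
    band_energy h j N f.
  transitivity (sqnorm mu (P : borel M -> R[i])).
    by apply: eq_Rintegral => x _; rewrite powR_mulrn ?cabs_ge0.
  rewrite /P (@sqnorm_span _ _ _ mu u) ?iota_uniq//; last first.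
  - exact: basis_orthonormal u_basis.
  - by move=> l; exact: laplace_eigenbasis_L2 u_basis.
  rewrite /band_energy big_mkcond; apply: eq_bigr => l _.
  rewrite /b cabsM cabs_conjc exprMn; case: ifPn => //.
  rewrite -ltNge natrX => jl.
  by rewrite band_limited_eq0// /cabs Normc.normc0 expr0n mul0r.
have := FM eta (2 ^ j)%N X (voronoi X) eta01.
rewrite expn_gt0 => /(_ isT uX).
rewrite mul1e => /(_ (le_trans meshX sepX)).
move=> /(_ (fun x xX => And3 (voronoi_measurable X x) (voronoi_self xX)
  (@voronoi_sub_cball _ _ X x))).
have X0 : X != [::].
  by apply: mesh_lt_pinfty_nonempty; rewrite (le_lt_trans meshX)// ltry.
move=> /(_ (voronoi_trivIset (X := X)) (voronoi_cover X0)).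
have jX : ((2 ^ j)%:R%:E * mesh X <= (c * eta / 2)%:E)%E.
  rewrite (@le_trans _ _ ((2 ^ j)%:R%:E * rad%:E)%E)//.
    by rewrite lee_wpmul2l// lee_fin.
  by rewrite -EFinM lee_fin natrX.
move=> /(_ jX P (ex_intro _ N (ex_intro _ b erefl))).
rewrite PE; congr (`| _ - _| <= _).
apply: eq_bigr => x _; rewrite powR_mulrn ?cabs_ge0//.
by rewrite (inner_framelet _ hb Lf cut).
Qed.

End framelet_coefficients.

(** An unordered sum is the supremum over finite subsets. Each finite subset of [D] lies in some
    [e n], because the [e n] increase to [D], and enlarging it to [e n] only adds nonnegative
    terms. *)
Lemma esum_exhaustion (R : realType) (I : choiceType) (D : set I)
    (e : nat -> seq I) (a : I -> R) :
  (forall i, 0 <= a i) -> (forall n, uniq (e n)) ->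
  (forall n, {subset e n <= e n.+1}) -> D = \bigcup_n [set` e n] ->
  (\esum_(i in D) (a i)%:E)%E =
  ereal_sup (range (fun n => (\sum_(i <- e n) a i)%:E)).
Proof.
move=> a0 ue en De.
have homo_e m n : (m <= n)%N -> {subset e m <= e n}.
  elim: n => [|n IH]; first by rewrite leqn0 => /eqP ->.
  by rewrite leq_eqVlt => /predU1P[->//|/IH h] i /h /en.
have sumE n : (\sum_(i \in [set` e n]) (a i)%:E = (\sum_(i <- e n) a i)%:E)%E.
  by rewrite -fsbig_seq// sumEFin.
apply/eqP; rewrite eq_le; apply/andP; split.
  apply: ge_ereal_sup => _ [A [fA AD] <-].
  have /finite_seqP[s As] := fA.
  have [n sn] : exists n, {subset s <= e n}.
    have : {in s, forall i, D i} by move=> i si; apply: AD; rewrite As.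
    elim: {As} s => [_|i s IH h]; first by exists 0%N.
    have [m hm] : exists n, {subset s <= e n}.
      by apply: IH => k ks; apply: h; rewrite inE ks orbT.
    have := h i (mem_head _ _); rewrite De => -[n _ /= ni].
    exists (maxn m n) => k; rewrite inE => /predU1P[->|/hm].
      exact: homo_e (leq_maxr _ _) _ ni.
    exact: homo_e (leq_maxl _ _) _.
  apply: (@le_trans _ _ (\sum_(i <- e n) a i)%:E); last first.
    by apply: ereal_sup_ubound; exists n.
  rewrite -sumE; apply: lee_fsum_nneg_subset; [exact: fA|exact: finite_seq| |].
    by move=> i; rewrite As !inE; exact: sn.
  by move=> i _; rewrite lee_fin.
apply: ge_ereal_sup => _ [n _ <-]; apply: esum_ge.
exists [set` e n]; last by rewrite sumE.
by split; [exact: finite_seq|rewrite De => i ei; exists n].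
Qed.

(** * Energy estimates and frame bounds for the oversampled system *)

Section framelet_system.
Context {R : realType} {d : nat} {M : pmetricType R} (G : riemannian d M).
Variables (mu : probability (borel M) R) (u : nat -> M -> R[i]) (lam : nat -> R).
Variables (gamma c : R) (J s r : nat).
Variables (alpha : R -> R[i]) (beta : 'I_r -> R -> R[i]) (X : nat -> seq M).
Hypothesis u_basis : laplace_eigenbasis G mu u lam.
Hypothesis c_gt0 : 0 < c.
Hypothesis c_FM : filbir_mhaskar mu u lam 1 2 c.
Hypothesis cond_a : forall l : nat,
  cabs (fourier alpha (lam l / 2 ^+ j)) @[j --> \oo] --> (1 : R).
Hypothesis cond_b : forall j l : nat, (J <= j)%N ->
  cabs (fourier alpha (lam l / 2 ^+ j.+1)) ^+ 2 =
  cabs (fourier alpha (lam l / 2 ^+ j)) ^+ 2 +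
  \sum_(k < r) cabs (fourier (beta k) (lam l / 2 ^+ j)) ^+ 2.
Hypothesis alpha_band : band_limited (fourier alpha).
Hypothesis beta_band : forall k, band_limited (fourier (beta k)).
Hypothesis gamma_gt0 : 0 < gamma.
Hypothesis X_family : nested_family d gamma X.
Let rho := 2 * gamma / c * 2 ^- s.
Hypothesis rho_lt1 : rho < 1.
Implicit Types (f : borel M -> R[i]) (n N : nat).

Let rho_gt0 : 0 < rho.
Proof. by rewrite mulr_gt0 ?invr_gt0 ?exprn_gt0// divr_gt0// mulr_gt0. Qed.

Let coef f (i : FS_index r) : R :=
  cabs (inner mu f (FS mu u lam alpha beta X J s i)) ^+ 2.

(** The low-pass indices and the high-pass ones of levels J, ..., J + n - 1: the finite piece of the
    system whose energy telescopes to that of alpha at level J + n. *)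
Fixpoint levels n : seq (@FS_index R M r) :=
  if n is n'.+1 then
    levels n' ++ [seq inr (J + n', k, x)%N |
                    k <- enum 'I_r, x <- X (J + n' + 1 + s)%N]
  else [seq inl x | x <- X (J + s)%N].

Lemma mem_levels n (i : FS_index r) : (i \in levels n) =
  match i with
  | inl x => x \in X (J + s)%N
  | inr (j, _, x) => (J <= j < J + n)%N && (x \in X (j + 1 + s)%N)
  end.
Proof.
elim: n => [|n IH] /=.
  case: i => [x|[[j k] x]]; first by rewrite mem_map// => ? ? [].
  rewrite addn0 ltnNge andbN/=; apply/negbTE/mapP => -[//].
rewrite mem_cat IH; case: i {IH} => [x|[[j k] x]].
  by case: (x \in _) => //=; apply/negbTE/allpairsP => -[[? ?] []].
rewrite (addnS J n) ltnS (leq_eqVlt j); have [->|jJn] := eqVneq j (J + n)%N.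
  rewrite ltnn andbF/= leq_addr/=; apply/allpairsP/idP.
    by move=> [[? ?] [_ /= xX [_ ->]]].
  move=> xX.
  by exists (k, x); split => //; rewrite mem_enum.
rewrite /= orbC; case: allpairsP => // -[[? ?] [_ _ [jE]]].
by rewrite jE eqxx in jJn.
Qed.

Lemma levels_uniq n : uniq (levels n).
Proof.
elim: n => [|n IH] /=.
  by rewrite map_inj_uniq; [exact: nodes_uniq X_family _|move=> ? ? []].
rewrite cat_uniq IH/=; apply/andP; split.
  apply/hasPn => _ /allpairsP[[k x] [_ _ ->]].
  by rewrite mem_levels ltnn andbF.
apply: allpairs_uniq; [exact: enum_uniq|exact: nodes_uniq X_family _|].
by move=> [? ?] [? ?] _ _ [-> ->].
Qed.

Lemma FS_dom_levels : @FS_dom R M r X J s = \bigcup_n [set` levels n].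
Proof.
apply/seteqP; split => [i iD|i [n _]].
  (* A high-pass index of level [j] is present once j < J + n, and n = j + 1 suffices. *)
  exists (if i is inr (j, _, _) then j.+1 else 0%N) => //=.
  rewrite mem_levels; case: i iD => [x//|[[j k] x]] /= /andP[-> ->].
  by rewrite andbT/= (addnS J j) ltnS leq_addl.
by rewrite /= mem_levels; case: i => [x//|[[j k] x]] /= /andP[/andP[-> _]].
Qed.

Lemma coef_sum_levels f : Defs.coef_sum mu (FS_dom X J s)
    (FS mu u lam alpha beta X J s) f =
  ereal_sup (range (fun n => (\sum_(i <- levels n) coef f i)%:E)).
Proof.
apply: esum_exhaustion => [i|||]; [exact: sqr_ge0|exact: levels_uniq| |].
  by move=> n i /= il; rewrite mem_cat il.
exact: FS_dom_levels.
Qed.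

Let weight_ge0 (Y : seq M) (x : M) : 0 <= weight mu Y x.
Proof. exact: fine_ge0. Qed.

(** Nodes of level m >= j + s have radius at most gamma 2^-(j+s), which offsets the degree 2^j. It
    is used with m = J + s for the low-pass part and m = j + 1 + s for the high-pass part. *)
Let level_quadrature h j m N f : band_limited h -> (j + s <= m)%N -> L2 mu f ->
  (forall l, (N <= l)%N -> 2 ^+ j < lam l) ->
  `|band_energy mu u lam h j N f - \sum_(x <- X m) weight mu (X m) x *
      cabs (inner mu f (framelet u lam h j x : borel M -> R[i])) ^+ 2|
    <= rho * band_energy mu u lam h j N f.
Proof.
move=> hb jm Lf cut.
apply: (framelet_quadrature u_basis c_FM _ (nodes_uniq X_family m)
  (nodes_mesh X_family m) (nodes_sep X_family m)) => //.
  by rewrite rho_gt0.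
rewrite /node_radius /rho.
(* This cancellation explains the constant 2 gamma / c: with eta = [rho] the Filbir-Mhaskar
   threshold is exactly gamma 2^-s. *)
have -> : c * (2 * gamma / c * 2 ^- s) / 2 = gamma * 2 ^- s.
  by field; rewrite expf_neq0//= lt0r_neq0.
rewrite mulrCA ler_pM2l// ler_pdivrMr ?exprn_gt0//.
rewrite mulrC ler_pdivlMr ?exprn_gt0// -exprD.
by rewrite ler_weXn2l// ler1n.
Qed.

Lemma band_energy_step n N f :
  band_energy mu u lam (fourier alpha) (J + n.+1) N f =
  band_energy mu u lam (fourier alpha) (J + n) N f +
  \sum_(k < r) band_energy mu u lam (fourier (beta k)) (J + n) N f.
Proof.
rewrite /band_energy exchange_big/= -big_split/=; apply: eq_bigr => l _.
by rewrite addnS cond_b ?leq_addr// mulrDl mulr_suml.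
Qed.

(** Each level errs by at most [rho] times its own energy. These energies add up, by
    [band_energy_step], to that of alpha at level J + n, so the relative error stays [rho] for every
    [n]. *)
Lemma levels_quadrature n N f : L2 mu f ->
  (forall l, (N <= l)%N -> 2 ^+ (J + n) < lam l) ->
  `|band_energy mu u lam (fourier alpha) (J + n) N f -
      \sum_(i <- levels n) coef f i|
    <= rho * band_energy mu u lam (fourier alpha) (J + n) N f.
Proof.
move=> Lf; elim: n => [|n IH] cut.
  rewrite /levels big_map addn0.
  under eq_bigr do rewrite /coef /FS (inner_weighted_framelet u_basis)//.
  by apply: level_quadrature; rewrite // -[J]addn0.
(* A cut-off for level J + n + 1 also serves level J + n, so one [N] works throughout the
   induction. *)
have cut' l : (N <= l)%N -> 2 ^+ (J + n) < lam l.
  move=> /cut; apply: le_lt_trans.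
  by rewrite ler_weXn2l ?ler1n// leq_add2l.
rewrite band_energy_step /= big_cat big_allpairs_dep/= big_enum/=.
rewrite opprD addrACA -sumrB mulrDr.
apply: (le_trans (ler_normD _ _)); apply: lerD; first exact: IH.
apply: (le_trans (ler_norm_sum _ _ _)); rewrite mulr_sumr; apply: ler_sum => k _.
under eq_bigr do rewrite /coef /FS (inner_weighted_framelet u_basis)//.
by apply: level_quadrature => //; rewrite addn1 leq_add2r.
Qed.

Let alpha_energy_cvg l :
  cabs (fourier alpha (lam l / 2 ^+ (J + n))) ^+ 2 @[n --> \oo] --> (1 : R).
Proof.
have h : cabs (fourier alpha (lam l / 2 ^+ j)) ^+ 2 @[j --> \oo] --> (1 : R).
  rewrite -[X in _ --> X](mulr1 1).
  exact: (cvgM (cond_a l) (cond_a l)).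
move: h; rewrite -(cvg_shiftn J); apply: cvg_trans; apply: near_eq_cvg.
by apply: nearW => n; rewrite /= addnC.
Qed.

(** By [cond_b] the sequence is nondecreasing in [n], so it stays below its limit 1. *)
Let alpha_energy_le1 l n : cabs (fourier alpha (lam l / 2 ^+ (J + n))) ^+ 2 <= 1.
Proof.
have inc : {homo (fun n => cabs (fourier alpha (lam l / 2 ^+ (J + n))) ^+ 2) :
    m p / (m <= p)%N >-> m <= p}.
  apply: homo_leq => [//|? ? ?|m]; first exact: le_trans.
  by rewrite addnS cond_b ?leq_addr// lerDl sumr_ge0// => k _; exact: sqr_ge0.
have := nondecreasing_cvgn_le inc (cvgP _ (alpha_energy_cvg l)) n.
by rewrite (cvg_lim (@Rhausdorff R) (alpha_energy_cvg l)).
Qed.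

(** Each finite piece is at most 1 + rho times the alpha energy, whose multipliers are at most 1, so
    Bessel's inequality bounds it by the norm of [f]. *)
Lemma coef_sum_le f : L2 mu f ->
  (Defs.coef_sum mu (FS_dom X J s) (FS mu u lam alpha beta X J s) f
    <= ((1 + rho) * sqnorm mu f)%:E)%E.
Proof.
move=> Lf; rewrite coef_sum_levels; apply: ge_ereal_sup => _ [n _ <-].
rewrite lee_fin; have [N cut] := eigenvalue_cutoff u_basis (2 ^+ (J + n)).
have := levels_quadrature Lf cut; rewrite ler_distlC => /andP[_ /le_trans]; apply.
rewrite -[X in X + _]mul1r -mulrDl ler_pM2l ?addr_gt0//.
have bE := bessel (fun l => laplace_eigenbasis_L2 l u_basis)
  (basis_orthonormal u_basis) N Lf.
apply: le_trans bE; rewrite /band_energy big_mkord; apply: ler_sum => l _.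
by rewrite ler_piMl ?sqr_ge0.
Qed.

(** Two successive limits: first n tends to infinity with the first [L] frequencies fixed, where
    each alpha multiplier tends to 1, then L tends to infinity by Parseval. Keeping [L] fixed first
    means that only finite sums pass to the limit in [n]. *)
Lemma coef_sum_ge f : L2 mu f ->
  (((1 - rho) * sqnorm mu f)%:E <=
    Defs.coef_sum mu (FS_dom X J s) (FS mu u lam alpha beta X J s) f)%E.
Proof.
move=> Lf; set C := Defs.coef_sum _ _ _ _.
have CE n : ((\sum_(i <- levels n) coef f i)%:E <= C)%E.
  by rewrite /C coef_sum_levels; apply: ereal_sup_ubound; exists n.
(* The upper bound already proved makes the coefficient sum finite, so both limits can be taken in
   the reals. *)
have [b Cb] : exists b, C = b%:E.
  have /fineK Cf : C \is a fin_num.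
    rewrite ge0_fin_numE; first exact: le_lt_trans (coef_sum_le Lf) (ltry _).
    by apply: le_trans (CE 0%N); rewrite lee_fin sumr_ge0// => i _; exact: sqr_ge0.
  by exists (fine C).
have rho1 : 0 <= 1 - rho by rewrite subr_ge0 ltW.
have head_le L n : (1 - rho) * (\sum_(l < L)
    cabs (fourier alpha (lam l / 2 ^+ (J + n))) ^+ 2 *
    cabs (inner mu f (u l : borel M -> R[i])) ^+ 2) <= b.
  have := CE n; rewrite Cb lee_fin; apply: le_trans.
  have [N cut] := eigenvalue_cutoff u_basis (2 ^+ (J + n)).
  (* Truncating at the maximum keeps a valid cut-off and makes the first [L] terms a part of the
     band energy; the other terms are nonnegative. *)
  have cutL l : (maxn L N <= l)%N -> 2 ^+ (J + n) < lam l.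
    by rewrite geq_max => /andP[_ /cut].
  have := levels_quadrature Lf cutL; rewrite ler_distlC => /andP[+ _].
  apply: le_trans; rewrite -[X in _ <= X - _]mul1r -mulrBl ler_wpM2l//.
  rewrite /band_energy -(big_mkord xpredT (fun l =>
    cabs (fourier alpha (lam l / 2 ^+ (J + n))) ^+ 2 *
    cabs (inner mu f (u l : borel M -> R[i])) ^+ 2)).
  rewrite [leRHS](big_cat_nat (leq0n L) (leq_maxl L N))//= lerDl.
  by rewrite sumr_ge0// => l _; rewrite mulr_ge0// sqr_ge0.
have partial_le L : (1 - rho) * (\sum_(l < L)
    cabs (inner mu f (u l : borel M -> R[i])) ^+ 2) <= b.
  have cv : (\sum_(l < L) cabs (fourier alpha (lam l / 2 ^+ (J + n))) ^+ 2 *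
      cabs (inner mu f (u l : borel M -> R[i])) ^+ 2) @[n --> \oo] -->
      \sum_(l < L) cabs (inner mu f (u l : borel M -> R[i])) ^+ 2.
    apply: cvg_big => [|l _]; first exact: add_continuous.
    by rewrite -[X in _ --> X]mul1r; apply: cvgMr_tmp; exact: alpha_energy_cvg.
  apply: (cvgr_to_le (cvgMl_tmp (a := 1 - rho) cv)).
  by apply: nearW => n; exact: head_le.
rewrite Cb lee_fin.
have cv := parseval (fun l => laplace_eigenbasis_L2 l u_basis)
  (basis_orthonormal u_basis) Lf (basis_complete u_basis Lf).
apply: (cvgr_to_le (cvgMl_tmp (a := 1 - rho) cv)).
by apply: nearW => L; exact: partial_le.
Qed.

Lemma FS_nearly_tight :
  nearly_tight mu (FS_dom X J s) (FS mu u lam alpha beta X J s) rho.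
Proof.
split; [by rewrite (ltW rho_gt0)|move=> f; exact: coef_sum_ge|].
by move=> f; exact: coef_sum_le.
Qed.

End framelet_system.

(** * Optimal frame bounds and asymptotic tightness *)

Section frame_bounds.
Context {disp : measure_display} {T : measurableType disp} {R : realType}.
Variable mu : {measure set T -> \bar R}.
Variables (I : choiceType) (f : T -> R[i]).
Hypotheses (f_L2 : L2 mu f) (f_unit : sqnorm mu f = 1).

(** Testing on the unit vector [f] shows that every lower bound is at most the coefficient sum of
    [f] and every upper bound at least that sum, which itself lies between 1 - eps and 1 + eps. *)
Lemma nearly_tight_frame_bounds (D : set I) (g : I -> T -> R[i]) (eps : R) :
  nearly_tight mu D g eps ->
  ((1 - eps)%:E <= lower_frame_bound mu D g <= (1 + eps)%:E)%E /\
  ((1 - eps)%:E <= upper_frame_bound mu D g <= (1 + eps)%:E)%E.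
Proof.
move=> [_ lb ub]; have := lb f f_L2; have := ub f f_L2.
rewrite f_unit !mulr1 => fub flb; split; apply/andP; split.
- by apply: ereal_sup_ubound; exists (1 - eps).
- apply: ge_ereal_sup => _ [A Alb <-].
  by have := Alb f f_L2; rewrite f_unit mulr1 => /le_trans; apply.
- apply/ereal_infP => _ [B Bub <-]; apply: (le_trans flb).
  by have := Bub f f_L2; rewrite f_unit mulr1.
- by apply: ereal_inf_lbound; exists (1 + eps).
Qed.

Lemma nearly_tight_asymptotically (D : nat -> set I) (g : nat -> I -> T -> R[i])
    (eps : nat -> R) : eps n @[n --> \oo] --> (0 : R) ->
  (\forall n \near \oo, nearly_tight mu (D n) (g n) (eps n)) ->
  asymptotically_tight mu D g.
Proof.
move=> eps0 nt.
have l1 : (1 - eps n)%:E @[n --> \oo] --> 1%:E.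
  by apply: cvg_EFin; [exact: nearW|rewrite -[X in _ --> X](subr0 1);
    apply: cvgB => //; exact: cvg_cst].
have u1 : (1 + eps n)%:E @[n --> \oo] --> 1%:E.
  by apply: cvg_EFin; [exact: nearW|rewrite -[X in _ --> X](addr0 1);
    apply: cvgD => //; exact: cvg_cst].
split; apply: squeeze_cvge l1 u1; apply: filterS nt => n /nearly_tight_frame_bounds;
  by case.
Qed.

End frame_bounds.

(** * From the support condition to band limitation, and the final assembly *)

Lemma supp_band_limited (R : realType) (h : R -> R[i]) :
  supp h `&` [set xi | 0 <= xi] `<=` [set xi | 0 <= xi <= 1] -> band_limited h.
Proof.
move=> hs xi xi1; apply: contraTeq xi1 => hxi; rewrite -leNgt.
have [xi0|/ltW xi0] := leP 0 xi; last exact: le_trans xi0 ler01.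
have /andP[] // : 0 <= xi <= 1.
by apply: hs; split => //; exact: subset_closure.
Qed.

Theorem theorem4p2 (R : realType) (d : nat) (M : pmetricType R)
  (G : riemannian d M) (mu : probability (borel M) R)
  (u : nat -> M -> R[i]) (lam : nat -> R)
  (RM c1 c2 gamma c : R) (J0 J r : nat)
  (alpha : R -> R[i]) (beta : 'I_r -> R -> R[i]) (X : nat -> seq M)
  (M_compact : compact [set: M]) (M_connected : connected [set: M])
  (M_metric : is_geodesic_metric G)
  (mu_volume : is_normalized_volume G mu)
  (RM_gt0 : 0 < RM) (c1_gt0 : 0 < c1) (c2_gt0 : 0 < c2)
  (ball_volume : forall (x : M) (rad : R), 0 < rad <= RM ->
     ((c1 * rad ^+ d)%:E <= mu (cball x rad%:E) <= (c2 * rad ^+ d)%:E)%E)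
  (u_basis : laplace_eigenbasis G mu u lam)
  (c_gt0 : 0 < c) (c_FM : filbir_mhaskar mu u lam 1 2 c)
  (J_ge : (J0 <= J)%N) (r_ge1 : (1 <= r)%N)
  (alpha_L1 : in_L1R alpha) (beta_L1 : forall k, in_L1R (beta k))
  (cond_a : forall l : nat,
     cabs (fourier alpha (lam l / 2 ^+ j)) @[j --> \oo] --> (1 : R))
  (cond_b : forall j l : nat, (J <= j)%N ->
     cabs (fourier alpha (lam l / 2 ^+ j.+1)) ^+ 2 =
     cabs (fourier alpha (lam l / 2 ^+ j)) ^+ 2 +
     \sum_(k < r) cabs (fourier (beta k) (lam l / 2 ^+ j)) ^+ 2)
  (cond_c : (supp (fourier alpha) `&` [set xi | 0 <= xi]) `|`
     \bigcup_k (supp (fourier (beta k)) `&` [set xi | 0 <= xi])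
     `<=` [set xi | 0 <= xi <= 1])
  (gamma_bounds : 0 < gamma < RM) (X_family : nested_family d gamma X) :
  let CM := 2 * gamma / c in
  let rho (s : nat) := CM * 2 ^- s in
  (forall s : nat, rho s < 1 ->
     nearly_tight mu (FS_dom X J s) (FS mu u lam alpha beta X J s) (rho s)) /\
  asymptotically_tight mu (fun s => FS_dom X J s)
    (fun s => FS mu u lam alpha beta X J s).

Proof.
move=> CM rho.
have /andP[gamma_gt0 _] := gamma_bounds.
have alpha_band : band_limited (fourier alpha).
  by apply: supp_band_limited => xi xi_supp; apply: cond_c; left.
have beta_band k : band_limited (fourier (beta k)).
  by apply: supp_band_limited => xi xi_supp; apply: cond_c; right; exists k.
have tight s : rho s < 1 ->
    nearly_tight mu (FS_dom X J s) (FS mu u lam alpha beta X J s) (rho s).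
  exact: (FS_nearly_tight u_basis c_gt0 c_FM cond_a cond_b).
split=> //.
have rho0 : rho s @[s --> \oo] --> (0 : R).
  have half : `|2^-1 : R| < 1 by rewrite ger0_norm ?invr_ge0// invf_lt1// ltr1n.
  have -> : rho = geometric CM 2^-1.
    by apply/funext => s; rewrite /rho /geometric/= exprVn.
  exact: cvg_geometric half.
(* The eigenfunction u_0 serves as the unit vector on which the optimal bounds are tested. *)
have u0_L2 := laplace_eigenbasis_L2 0 u_basis.
have u0_unit : sqnorm mu (u 0%N : borel M -> R[i]) = 1.
  by apply: complexI; rewrite -inner_self (basis_orthonormal u_basis).
apply: (nearly_tight_asymptotically u0_L2 u0_unit rho0).
(* Near tightness is available only once [rho s] < 1, which holds for all large [s]; this suffices
   for the limit. *)
have rho_lt1 : \forall s \near \oo, rho s < 1 by exact: (cvgr_lt 0 rho0 1 ltr01).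
by apply: filterS rho_lt1 => s; exact: tight.
Qed.
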